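(* If a skew diagram $D$ is a sum of fat staircases, then the columns of $D$ have pairwise distinct lengths.
   Context: A composition $\alpha=(\alpha_1,\dots,\alpha_n)$ is a finite sequence of positive integers. $\delta_\alpha=(n^{\alpha_n},(n-1)^{\alpha_{n-1}},\dots,1^{\alpha_1})$ is the partition with exactly $\alpha_i$ parts equal to $i$ for each $i$. A partition $\nu$ is a fat staircase if $\nu=\delta_\alpha$ for some composition $\alpha$. A skew diagram $D=\rho/\kappa$ is called a sum of fat staircases if in the Schur expansion $s_D=\sum_\nu c_{\kappa\nu}^{\rho}s_\nu$ of its skew Schur function ($c_{\kappa\nu}^\rho$ the Littlewood-Richardson coefficients) we have $c_{\kappa\nu}^{\rho}=0$ for every partition $\nu$ that is not a fat staircase. The columns of $D$ are its nonempty columns; the length of a column is the number of boxes of $D$ in it. *)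

(* Defs.v *)
From HB Require Import structures.
From mathcomp Require Import all_boot all_order all_algebra.
From mathcomp Require Import finmap mpoly.

Set Implicit Arguments.
Unset Strict Implicit.
Unset Printing Implicit Defensive.

Import GRing.Theory.
Local Open Scope ring_scope.

Definition is_intpart (s : seq nat) : bool := sorted geq s && (0%N \notin s).

Record intpart := IntPart { parts :> seq nat; _ : is_intpart parts }.

HB.instance Definition _ := [isSub for parts].
HB.instance Definition _ := [Choice of intpart by <:].

Definition empty_part : intpart := @IntPart [::] isT.

(* [row_len nu i] is the i-th part, counted from 0, and is 0 past the last
   part. *)
Definition row_len (nu : intpart) (i : nat) : nat := nth 0%N nu i.

Record skew_diagram := SkewDiagram {
  outer : intpart;
  inner : intpart;
  _ : forall i, (row_len inner i <= row_len outer i)%N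
}.

Lemma empty_part_sub (nu : intpart) (i : nat) :
  (row_len empty_part i <= row_len nu i)%N.
Proof. by rewrite /row_len nth_nil. Qed.

Definition straight (nu : intpart) : skew_diagram :=
  SkewDiagram (empty_part_sub nu).

(* Boxes are pairs (row, column), both counted from 0, with rows going down;
   all of them lie in a [size outer] by [row_len outer 0] rectangle. *)
Definition box (D : skew_diagram) : finType :=
  {x : 'I_(size (outer D)) * 'I_(row_len (outer D) 0) |
    (row_len (inner D) x.1 <= x.2 < row_len (outer D) x.1)%N}.

Definition box_row (D : skew_diagram) (b : box D) : nat := (val b).1.
Definition box_col (D : skew_diagram) (b : box D) : nat := (val b).2.

Definition semistandard (D : skew_diagram) (N : nat)
    (T : {ffun box D -> 'I_N}) : bool :=
  [forall a : box D, forall b : box D,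
    ((box_row a == box_row b) && (box_col a <= box_col b) ==> (T a <= T b))
    && ((box_col a == box_col b) && (box_row a < box_row b) ==> (T a < T b))]%N.

(* The skew Schur function s_D restricted to the variables x_0, ..., x_(N-1). *)
Definition skew_schur (D : skew_diagram) (N : nat) : {mpoly int[N]} :=
  \sum_(T : {ffun box D -> 'I_N} | semistandard T) \prod_(b : box D) 'X_(T b).

(* s_D = \sum_nu c_nu s_nu in the ring of symmetric functions over the
   integers: an identity between symmetric functions holds when its
   restrictions to N variables hold for all N. The Schur functions being
   linearly independent, [c] is determined by [D], and its value at [nu] is the
   Littlewood-Richardson coefficient of [outer D], [inner D] and [nu]. *)
Definition schur_expansion (D : skew_diagram)
    (c : {fsfun intpart -> int with 0}) : Prop :=
  forall N : nat,
    skew_schur D N =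
    \sum_(nu <- finsupp c) c nu *: skew_schur (straight nu) N.

Definition is_composition (alpha : seq nat) : bool := 0%N \notin alpha.

(* [alpha] is indexed from 0, so the multiplicity of the part [i] is
   [nth 0 alpha i.-1]. *)
Definition delta (alpha : seq nat) : seq nat :=
  flatten [seq nseq (nth 0%N alpha i.-1) i | i <- rev (iota 1 (size alpha))].

Definition fat_staircase (nu : intpart) : Prop :=
  exists2 alpha : seq nat, is_composition alpha & parts nu = delta alpha.

Definition sum_of_fat_staircases (D : skew_diagram) : Prop :=
  exists2 c : {fsfun intpart -> int with 0},
    schur_expansion D c & forall nu : intpart, ~ fat_staircase nu -> c nu = 0.

Definition col_length (D : skew_diagram) (j : nat) : nat :=
  #|[set b : box D | box_col b == j]|.

(* Main.v *)
(** The depth of a box is the number of boxes above it in its column. It is the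
    least entry a semistandard tableau can have there, and filling each box with
    its depth is itself semistandard; hence the content of this filling
    dominates the content of every tableau of the same shape. For a skew diagram
    [D] its [i]-th entry is the number of columns of length more than [i], and
    for a straight shape it is the shape. Comparing the coefficients of these
    extremal monomials in the Schur expansion of [D] shows that a
    dominance-maximal [nu] in the expansion is the conjugate of the partition of
    column lengths of [D]. Consecutive rows of a fat staircase differ by at most
    one, whereas two columns of length [L] make rows [L - 1] and [L] of [nu],
    counted from [0], differ by at least two. *)

Require Import Defs.
From mathcomp Require Import all_boot all_order all_algebra.
From mathcomp Require Import finmap mpoly zify.

Set Implicit Arguments.
Unset Strict Implicit.
Unset Printing Implicit Defensive.

Import GRing.Theory.

(** * Rows of partitions and boxes of skew diagrams *)

Lemma row_len_anti (nu : intpart) i j :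
  i <= j -> row_len nu j <= row_len nu i.
Proof.
case: nu => s /=; rewrite /is_intpart /row_len /= => /andP[ss _] ij.
have [jz|jz] := ltnP j (size s); last by rewrite nth_default.
have geq_trans : transitive geq by move=> a b c /= ba cb; exact: leq_trans cb ba.
apply: (sorted_leq_nth geq_trans _ 0 ss) => //; first exact: leqnn.
by rewrite inE; apply: leq_ltn_trans jz.
Qed.

Lemma row_len_gt0 (nu : intpart) i : (0 < row_len nu i) = (i < size nu).
Proof.
case: nu => s /=; rewrite /is_intpart /row_len /= => /andP[_ s0].
have [iz|iz] := ltnP i (size s); last by rewrite nth_default.
by rewrite lt0n; apply: contraNneq s0 => <-; rewrite mem_nth.
Qed.

Lemma intpart_ext (mu nu : intpart) N : size mu <= N -> size nu <= N ->
  (forall i, i < N -> row_len mu i = row_len nu i) -> mu = nu.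
Proof.
move=> muN nuN eq_row.
have eq_all i : row_len mu i = row_len nu i.
  have [/eq_row//|Ni] := ltnP i N.
  by rewrite /row_len !nth_default //; apply: leq_trans Ni.
have eq_size : size mu = size nu.
  have le_size (a b : intpart) : row_len a =1 row_len b -> size a <= size b.
    move=> ab; rewrite leqNgt; apply/negP.
    by rewrite -row_len_gt0 ab row_len_gt0 ltnn.
  by apply/eqP; rewrite eqn_leq !le_size.
by apply: val_inj; apply: (@eq_from_nth _ 0) => // i _; apply: eq_all.
Qed.

Lemma mem_box (D : skew_diagram) (b : box D) :
  row_len (inner D) (box_row b) <= box_col b < row_len (outer D) (box_row b).
Proof. exact: (valP b). Qed.

Lemma box_ext (D : skew_diagram) (a b : box D) :
  box_row a = box_row b -> box_col a = box_col b -> a = b.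
Proof.
move=> ab_row ab_col; apply: val_inj; apply: injective_projections.
  exact: val_inj.
exact: val_inj.
Qed.

Lemma exists_box (D : skew_diagram) r c :
  row_len (inner D) r <= c < row_len (outer D) r ->
  exists2 b : box D, box_row b = r & box_col b = c.
Proof.
move=> rc; have /andP[_ c_lt] := rc.
have r_lt : r < size (outer D).
  by rewrite -row_len_gt0; apply: leq_trans c_lt.
have c_lt0 : c < row_len (outer D) 0 by apply: leq_trans c_lt (row_len_anti _ _).
by exists (Sub (Ordinal r_lt, Ordinal c_lt0) rc).
Qed.

(** * Depths of boxes and lengths of columns *)

Section Depth.

Variable D : skew_diagram.
Implicit Types a b : box D.

Definition above b : {set box D} :=
  [set a | (box_col a == box_col b) && (box_row a < box_row b)].

Definition depth b := #|above b|.

Definition depth_mult i := #|[set b | depth b == i]|.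

(** These are the partial sums of [depth_mult], so comparing them for all [k] is the dominance
    order. *)
Definition depth_count k := #|[set b | depth b < k]|.

Lemma depth_countS k : depth_count k.+1 = depth_count k + depth_mult k.
Proof.
rewrite /depth_count /depth_mult.
have -> : [set b | depth b < k.+1] = [set b | depth b < k] :|: [set b | depth b == k].
  by apply/setP => b; rewrite !inE; lia.
rewrite cardsU (_ : _ :&: _ = set0) ?cards0 ?subn0 //.
by apply/setP => b; rewrite !inE; lia.
Qed.

(** Outer rows grow upwards, so above [b] only the inner boundary can cut the column off. The column
    now enters only as a threshold, which makes depths in different columns comparable. *)
Lemma depth_rows b :
  depth b = #|[set r : 'I_(size (outer D)) |
    (r < box_row b) && (row_len (inner D) r <= box_col b)]|.
Proof.
rewrite /depth -(card_in_imset (f := fun a : box D => (val a).1)); last first.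
  move=> a a'; rewrite !inE => /andP[/eqP ac _] /andP[/eqP a'c _] aa'.
  by apply: box_ext; rewrite ?ac // /box_row aa'.
apply: eq_card => r; rewrite inE; apply/imsetP/idP.
  move=> [a]; rewrite inE => /andP[/eqP ac ab] -> .
  by rewrite ab -ac; case/andP: (mem_box a).
move=> /andP[rb inr].
have := mem_box b => /andP[_ bout].
case: (@exists_box D r (box_col b)) => [|a ar ac].
  by rewrite inr (leq_trans bout) // row_len_anti // ltnW.
exists a; first by rewrite inE ac eqxx ar.
exact: val_inj.
Qed.

Lemma depth_lt_size b : depth b < size (outer D).
Proof.
rewrite depth_rows -[ltnRHS]card_ord; apply: proper_card.
apply/properP; split; first exact/subsetP.
by exists (val b).1 => //; rewrite inE ltnn.
Qed.

Lemma depth_row_homo a b :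
  box_row a = box_row b -> box_col a <= box_col b -> depth a <= depth b.
Proof.
move=> ab ac; rewrite !depth_rows; apply: subset_leq_card.
apply/subsetP => r; rewrite !inE ab => /andP[-> inr].
exact: leq_trans ac.
Qed.

Lemma depth_col_homo a b :
  box_col a = box_col b -> box_row a < box_row b -> depth a < depth b.
Proof.
move=> ac ab; apply: proper_card; apply/properP; split.
  apply/subsetP => x; rewrite !inE ac => /andP[-> xa].
  exact: ltn_trans ab.
by exists a; rewrite !inE ?ac ?eqxx ?ltnn.
Qed.

Lemma depth_col_inj a b : box_col a = box_col b -> depth a = depth b -> a = b.
Proof.
move=> ac ad; apply: box_ext => //; case: (ltngtP (box_row a) (box_row b)) => //.
  by move=> /(depth_col_homo ac); rewrite ad ltnn.
by move=> /(depth_col_homo (esym ac)); rewrite ad ltnn.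
Qed.

Lemma semistandard_col N (T : {ffun box D -> 'I_N}) a b : semistandard T ->
  box_col a = box_col b -> box_row a < box_row b -> T a < T b.
Proof.
move=> /forallP/(_ a)/forallP/(_ b)/andP[_ /implyP sT] ac ab.
by apply: sT; rewrite ac eqxx.
Qed.

(* The entries above [b] in its column are pairwise distinct and smaller than
   [T b]. *)
Lemma depth_le_semistandard N (T : {ffun box D -> 'I_N}) b :
  semistandard T -> depth b <= T b.
Proof.
move=> sT; rewrite /depth -(card_in_imset (f := T)); last first.
  move=> a a'; rewrite !inE => /andP[/eqP ac _] /andP[/eqP a'c _] aa'.
  have c_eq : box_col a = box_col a' by rewrite ac.
  apply: box_ext => //; case: (ltngtP (box_row a) (box_row a')) => //.
    by move=> /(semistandard_col sT c_eq); rewrite aa' ltnn.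
  by move=> /(semistandard_col sT (esym c_eq)); rewrite aa' ltnn.
rewrite cardE -(size_map val) -[leqRHS](size_iota 0); apply: uniq_leq_size.
  by rewrite map_inj_uniq ?enum_uniq //; apply: val_inj.
move=> i /mapP[t]; rewrite mem_enum => /imsetP[a]; rewrite inE => /andP[/eqP ac ab] -> ->.
by rewrite mem_iota /= add0n (semistandard_col sT).
Qed.

(** [inord] needs a nonempty alphabet, hence [N.+1] letters. *)
Definition depth_tableau N : {ffun box D -> 'I_N.+1} :=
  [ffun b => inord (depth b)].

Lemma depth_tableauE N b : size (outer D) <= N.+1 ->
  depth_tableau N b = depth b :> nat.
Proof.
by move=> DN; rewrite ffunE inordK // (leq_trans (depth_lt_size b)).
Qed.

Lemma semistandard_depth_tableau N :
  size (outer D) <= N.+1 -> semistandard (depth_tableau N).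
Proof.
move=> DN; apply/forallP => a; apply/forallP => b.
rewrite !depth_tableauE //; apply/andP; split; apply/implyP => /andP[/eqP ab].
  exact: depth_row_homo.
exact: depth_col_homo.
Qed.

(** The depths in a column are distinct, below its length, and as many as its length, so they fill
    an initial interval. *)
Lemma depth_in_col j i :
  reflect (exists2 b, box_col b = j & depth b = i) (i < col_length D j).
Proof.
pose A := [set b : box D | box_col b == j].
have memA b : b \in enum A -> box_col b = j.
  by rewrite mem_enum inE => /eqP.
have Auniq : uniq [seq depth b | b <- enum A].
  rewrite map_inj_in_uniq ?enum_uniq // => a b /memA aj /memA bj.
  by apply: depth_col_inj; rewrite aj.
have Asub : {subset [seq depth b | b <- enum A] <= iota 0 (col_length D j)}.
  move=> _ /mapP[b /memA bj ->]; rewrite mem_iota /= add0n.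
  apply: proper_card; apply/properP; split.
    by apply/subsetP => x; rewrite !inE bj => /andP[].
  by exists b; rewrite inE ?bj ?eqxx ?ltnn ?andbF.
have [|_ Aeq] := uniq_min_size Auniq Asub.
  by rewrite size_iota size_map -cardE.
have := Aeq i; rewrite mem_iota /= add0n => <-.
apply: (iffP mapP) => [[b /memA bj ->]|[b bj <-]]; exists b => //.
by rewrite mem_enum inE bj.
Qed.

(** Each column longer than [i] has exactly one box of depth [i], and no other column has any. *)
Lemma depth_mult_cols i :
  depth_mult i = #|[set j : 'I_(row_len (outer D) 0) | i < col_length D j]|.
Proof.
rewrite /depth_mult -(card_in_imset (f := fun b : box D => (val b).2)); last first.
  move=> a b; rewrite !inE => /eqP ai /eqP bi ab.
  by apply: depth_col_inj; rewrite ?ai // /box_col ab.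
apply: eq_card => j; rewrite inE; apply/imsetP/depth_in_col.
  by move=> [b]; rewrite inE => /eqP bi ->; exists b.
by move=> [b bj bi]; exists b; [rewrite inE bi | apply: val_inj].
Qed.

(** With [L] the common length, the columns longer than [L] are also longer than [L.-1], and so are
    the two further columns [j] and [k]. *)
Lemma depth_mult_drop j k : j != k -> 0 < col_length D j ->
  col_length D j = col_length D k ->
  depth_mult (col_length D j) + 2 <= depth_mult (col_length D j).-1.
Proof.
move=> jk j0 jk_len; rewrite !depth_mult_cols.
set L := col_length D j in j0 jk_len *.
have lt_col m : 0 < col_length D m -> m < row_len (outer D) 0.
  by move=> /depth_in_col[b <- _]; apply: (valP (val b).2).
have k0 : 0 < col_length D k by rewrite -jk_len.
pose J := Ordinal (lt_col j j0); pose K := Ordinal (lt_col k k0).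
have <- : #|[set J; K]| = 2 by rewrite cards2 -val_eqE /= jk.
have <- : #|[set i : 'I_(row_len (outer D) 0) | L < col_length D i] :|: [set J; K]| =
    #|[set i : 'I_(row_len (outer D) 0) | L < col_length D i]| + #|[set J; K]|.
  rewrite cardsU (_ : _ :&: _ = set0) ?cards0 ?subn0 //.
  apply/setP => i; rewrite !inE; apply/negP => /andP[Li /orP[]/eqP iE].
    by move: Li; rewrite iE /= ltnn.
  by move: Li; rewrite iE /= jk_len ltnn.
apply: subset_leq_card; apply/subsetP => i; rewrite !inE => /orP[|/orP[]/eqP->] /=.
- by apply: leq_trans; lia.
- by rewrite -/L; lia.
- by rewrite -jk_len; lia.
Qed.

End Depth.

(** * Straight shapes *)

Lemma card_ord_lt n m : m <= n -> #|[set r : 'I_n | r < m]| = m.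
Proof.
by move=> mn; rewrite -sum1dep_card (big_ord_narrow mn) sum1_card card_ord.
Qed.

Lemma depth_straight (nu : intpart) (b : box (straight nu)) :
  depth b = box_row b.
Proof.
rewrite depth_rows.
transitivity #|[set r : 'I_(size nu) | r < box_row b]|.
  by apply: eq_card => r; rewrite !inE /row_len nth_nil andbT.
have bs : box_row b <= size nu by apply: ltnW; apply: (valP (val b).1).
exact: card_ord_lt.
Qed.

Lemma col_length_straight (nu : intpart) i j :
  (i < col_length (straight nu) j) = (j < row_len nu i).
Proof.
apply/depth_in_col/idP => [[b <- <-]|ji].
  by rewrite depth_straight; case/andP: (mem_box b).
case: (@exists_box (straight nu) i j) => [|b bi bj].
  by rewrite /= {1}/row_len nth_nil.
by exists b; rewrite // depth_straight.
Qed.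

Lemma depth_mult_straight (nu : intpart) i :
  depth_mult (straight nu) i = row_len nu i.
Proof.
rewrite depth_mult_cols /=.
have le0 : row_len nu i <= row_len nu 0 by apply: row_len_anti.
rewrite -[RHS](card_ord_lt le0).
by apply: eq_card => j; rewrite !inE col_length_straight.
Qed.

Local Open Scope ring_scope.

(** * Contents of tableaux and monomials of Schur functions *)

Definition content (D : skew_diagram) N (T : {ffun box D -> 'I_N}) : 'X_{1..N} :=
  (\sum_(b : box D) U_(T b))%MM.

Lemma contentE (D : skew_diagram) N (T : {ffun box D -> 'I_N}) i :
  content T i = #|[set b | T b == i]|.
Proof.
rewrite /content mnm_sumE -sum1dep_card [RHS]big_mkcond /=.
by apply: eq_bigr => b _; rewrite mnm1E eq_sym; case: eqP.
Qed.

(** The content alone determines these counts, so tableaux of different shapes can be compared. *)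
Lemma content_count (D E : skew_diagram) N (T : {ffun box D -> 'I_N})
    (U : {ffun box E -> 'I_N}) k :
  content T = content U -> #|[set b | T b < k]%N| = #|[set b | U b < k]%N|.
Proof.
move=> TU.
have count_sum (F : skew_diagram) (V : {ffun box F -> 'I_N}) :
    #|[set b | V b < k]%N| = (\sum_(i < N | i < k) content V i)%N.
  rewrite -sum1dep_card (partition_big V (fun i : 'I_N => i < k)%N) //=.
  apply: eq_bigr => i ik; rewrite contentE -sum1dep_card.
  by apply: eq_bigl => b; case: eqP => [->|]; rewrite ?ik ?andbF.
by rewrite !count_sum TU.
Qed.

Lemma mcoeff_skew_schur (D : skew_diagram) N (m : 'X_{1..N}) :
  (skew_schur D N)@_m =
  #|[set T : {ffun box D -> 'I_N} | semistandard T && (content T == m)]|%:R.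
Proof.
rewrite /skew_schur raddf_sum /= -sum1dep_card natr_sum big_mkcondr /=.
apply: eq_bigr => T _.
have -> : \prod_(b : box D) 'X_(T b) = 'X_[content T] :> {mpoly int[N]}.
  by rewrite /content mprodXE.
by rewrite mcoeffX; case: eqP.
Qed.

Lemma skew_schur_supp (D : skew_diagram) N (m : 'X_{1..N}) :
  reflect (exists2 T : {ffun box D -> 'I_N}, semistandard T & content T = m)
          ((skew_schur D N)@_m != 0).
Proof.
rewrite mcoeff_skew_schur Num.Theory.pnatr_eq0 cards_eq0.
apply: (iffP (set0Pn _)) => [[T]|[T sT Tm]]; last by exists T; rewrite inE sT Tm eqxx.
by rewrite inE => /andP[sT /eqP Tm]; exists T.
Qed.

Lemma depth_tableau_supp (D : skew_diagram) N : (size (outer D) <= N.+1)%N ->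
  (skew_schur D N.+1)@_(content (depth_tableau D N)) != 0.
Proof.
move=> DN; apply/skew_schur_supp; exists (depth_tableau D N) => //.
exact: semistandard_depth_tableau.
Qed.

(** Some tableau of shape [D] has the content of the depth filling of [E]. Its entries are at least
    the depths, so entries below [k] sit in boxes of depth below [k]. *)
Lemma skew_schur_dominance (D E : skew_diagram) N k :
  (size (outer E) <= N.+1)%N ->
  (skew_schur D N.+1)@_(content (depth_tableau E N)) != 0 ->
  (depth_count E k <= depth_count D k)%N.
Proof.
move=> EN /skew_schur_supp[T sT TE].
have -> : depth_count E k = #|[set b | depth_tableau E N b < k]%N|.
  by apply: eq_card => b; rewrite !inE depth_tableauE.
rewrite -(content_count k TE); apply: subset_leq_card.
apply/subsetP => b; rewrite !inE; apply: leq_ltn_trans.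
exact: depth_le_semistandard.
Qed.

Lemma depth_mult_eq (D E : skew_diagram) N :
  (forall k, (k <= N)%N -> depth_count D k = depth_count E k) ->
  forall i, (i < N)%N -> depth_mult D i = depth_mult E i.
Proof.
move=> DE i iN; apply: (@addnI (depth_count D i)).
by rewrite -depth_countS (DE i) 1?ltnW // -depth_countS DE.
Qed.

(** This lets the maximum of one number, a sum of partial sums, replace maximality in the dominance
    order. *)
Lemma eq_of_leq_sum (F G : nat -> nat) N : (forall k, F k <= G k)%N ->
  (\sum_(k < N) G k <= \sum_(k < N) F k)%N ->
  forall k, (k < N)%N -> F k = G k.
Proof.
move=> FG le_sum k kN; apply/eqP.
have [_] := leqif_sum (fun (i : 'I_N) (_ : true) => leqif_eq (FG i)).
rewrite eqn_leq leq_sum //= le_sum => /esym/forallP/(_ (Ordinal kN)).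
by [].
Qed.

(** * Consecutive rows of fat staircases *)

Lemma delta_step n (f : nat -> nat) k :
  (forall i, (0 < i <= n)%N -> (0 < f i)%N) ->
  let s := flatten [seq nseq (f i) i | i <- rev (iota 1 n)] in
  nth 0%N s 0 = n /\ (nth 0%N s k <= (nth 0%N s k.+1).+1)%N.
Proof.
elim: n k => [|n IHn] k f_gt0; first by rewrite /= nth_nil.
have -> : rev (iota 1 n.+1) = n.+1 :: rev (iota 1 n).
  by rewrite -(addn1 n) iotaD rev_cat /= add1n addn1.
rewrite /=.
have {}IHn l := IHn l (fun i ltin => f_gt0 i ltac:(lia)).
have fn := f_gt0 n.+1 ltac:(lia).
rewrite !nth_cat !size_nseq !nth_nseq fn; split=> //.
have [k_lt|k_ge] := ltnP k (f n.+1); last first.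
  by rewrite ltnNge (leq_trans k_ge) //= subSn //; case: (IHn (k - f n.+1)%N).
have [_|k1_ge] := ltnP k.+1 (f n.+1); first exact: leqW.
(* Position [k] holds the last copy of [n.+1]; the next entry heads the rest and equals [n], being
   the default of [nth] when [n = 0]. This is why the induction carries the first entry along. *)
rewrite (_ : k.+1 - _ = 0)%N; last by lia.
by case: (IHn 0%N) => ->.
Qed.

Lemma fat_staircase_step (nu : intpart) i :
  fat_staircase nu -> (row_len nu i <= (row_len nu i.+1).+1)%N.
Proof.
move=> [alpha alpha0 nuE]; rewrite /row_len nuE /delta.
have [|_ //] := @delta_step (size alpha) (fun i => nth 0%N alpha i.-1) i.
move=> j /andP[j0 jn]; rewrite lt0n; apply: contraNneq alpha0 => <-.
by apply: mem_nth; case: j j0 jn.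
Qed.

(* The partition conjugate to the sorted column lengths of [D], whose [i]-th
   part is [depth_mult D i], occurs in the Schur expansion of [D]. *)
Lemma schur_expansion_max (D : skew_diagram) (c : {fsfun intpart -> int with 0}) :
  schur_expansion D c ->
  exists2 nu, c nu != 0 & forall i, (i <= size (outer D))%N ->
    row_len nu i = depth_mult D i.
Proof.
move=> Dc.
(* Enough variables for the depth fillings of [D] and of every shape in the expansion. *)
pose N := (size (outer D) + \sum_(nu <- finsupp c) size (parts nu))%N.
have DN : (size (outer D) <= N.+1)%N by rewrite leqW // leq_addr.
have nuN nu : c nu != 0 -> (size nu <= N.+1)%N.
  rewrite -mem_finsupp => nuc; rewrite leqW // /N (big_fsetD1 nu) //=.
  by rewrite addnCA leq_addr.
(* The range reaches [k = N.+1], since [depth_mult] at [N] is a difference of the counts at [N.+1]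
   and [N]. *)
pose S (E : skew_diagram) := (\sum_(k < N.+2) depth_count E k)%N.
have coefD m : (skew_schur D N.+1)@_m =
    \sum_(nu <- finsupp c) c nu * (skew_schur (straight nu) N.+1)@_m.
  rewrite Dc raddf_sum /=; apply: eq_bigr => nu _; exact: mcoeffZ.
(* The extremal monomial of [D] must occur in some [s_mu] of the expansion, and such a [mu]
   dominates [D]. *)
have [mu muc Dmu] : exists2 mu, c mu != 0 &
    forall k, (depth_count D k <= depth_count (straight mu) k)%N.
  have := depth_tableau_supp DN; rewrite coefD.
  case: (boolP [exists mu : finsupp c, (skew_schur (straight (val mu)) N.+1)@_
      (content (depth_tableau D N)) != 0]).
    move=> /existsP[mu mu_supp] _; exists (val mu).
      by rewrite -mem_finsupp; apply: valP.
    by move=> k; apply: skew_schur_dominance mu_supp.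
  move=> /existsPn no_mu; rewrite big_seq big1 ?eqxx // => nu nuc.
  by have := no_mu [` nuc]%fset; rewrite negbK /= => /eqP ->; rewrite mulr0.
have mu_in : mu \in finsupp c by rewrite mem_finsupp.
case: (arg_maxnP (fun nu : finsupp c => S (straight (val nu)))
  (i0 := [` mu_in]%fset) (P := predT) isT) => -[lam lam_in] _ /= lam_max.
have lamc : c lam != 0 by rewrite -mem_finsupp.
(* No cancellation is possible: a [nu] of the expansion whose Schur function contains the extremal
   monomial of [lam] dominates [lam], hence equals it by maximality of [S]. *)
have lam_supp : (skew_schur D N.+1)@_(content (depth_tableau (straight lam) N)) != 0.
  rewrite coefD (big_fsetD1 lam) //= [X in _ + X]big1_seq ?addr0.
    by rewrite mulf_neq0 // depth_tableau_supp //= nuN.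
  move=> nu /andP[_]; rewrite !inE => /andP[nu_lam nuc].
  apply/eqP; rewrite mulf_eq0; apply/orP; right.
  apply: contraNT nu_lam => nu_supp; apply/eqP.
  have le_depth k := skew_schur_dominance (E := straight lam) k (nuN _ lamc) nu_supp.
  have eq_depth := eq_of_leq_sum le_depth (lam_max [` nuc]%fset isT).
  apply: (@intpart_ext _ _ N.+1); rewrite ?nuN -?mem_finsupp // => i iN.
  rewrite -!depth_mult_straight; apply/esym; move: i iN.
  by apply: depth_mult_eq => k kN; apply: eq_depth.
have lamD k := skew_schur_dominance (E := straight lam) k (nuN _ lamc) lam_supp.
exists lam => // i iD; rewrite -depth_mult_straight.
have : (i < N.+1)%N by rewrite ltnS (leq_trans iD) // leq_addr.
(* In dominance [D] lies between [lam] and [mu], while [S] is no larger at [mu] than at [lam]; so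
   [lam] and [D] have equal counts. *)
move: i {iD}; apply: depth_mult_eq => k kN; apply: (eq_of_leq_sum lamD (N := N.+2)) => //.
apply: leq_trans (lam_max [` mu_in]%fset isT).
by apply: leq_sum.
Qed.

Theorem theorem4p5 (D : skew_diagram) :
  sum_of_fat_staircases D ->
  forall j k : nat,
    (0 < col_length D j)%N -> (0 < col_length D k)%N ->
    j <> k -> col_length D j <> col_length D k.
Proof.
move=> [c Dc c0] j k j_gt0 _ /eqP jk jk_len.
have [nu nuc nuD] := schur_expansion_max Dc.
have drop := depth_mult_drop jk j_gt0 jk_len.
(* [nuD] covers only indices up to the number of rows; the deepest box of column [j] bounds its
   length by that number. *)
have len_le : (col_length D j <= size (outer D))%N.
  have /depth_in_col[b _ bE] : ((col_length D j).-1 < col_length D j)%N by lia.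
  by have := depth_lt_size b; rewrite bE; lia.
rewrite -!nuD // in drop; last by lia.
case/eqP: nuc; apply: c0 => /(@fat_staircase_step _ (col_length D j).-1).
by rewrite prednK //; lia.
Qed.
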